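(* Let $u$ be a standard word of length $n$. The catabolism insertion algorithm with input $u$ satisfies: (i) after every step of the algorithm, the word-partition pair $(x,\nu)$ is such that the concatenated word $x\ \mathrm{rowword}(Z_\nu)$ is the cocharge labeling of some standard word; (ii) the algorithm terminates, in at most $n+\binom{n}{2}$ steps; (iii) $F(u)=F(v)$ if $v$ is a non-zero corotation of $u$; (iv) $F(u)=F(v)$ if $v$ is obtained from $u$ by a catabolism transformation; (v) $F(u)=F(v)$ if $v$ is obtained from $u$ by a Knuth transformation; (vi) $F(u)=\mathrm{ctype}(P(u))$.
   Context: A standard word of length $n$ is a permutation $w=w_1\cdots w_n$ of $1,\dots,n$. Tableaux are in English notation (rows weakly increasing west to east, columns strictly increasing north to south); $\mathrm{rowword}(T)$ is the row reading word (rows read left to right, from the bottom row to the top row); $P(w)$ is the (Schensted row) insertion tableau of a word $w$, so $P(\mathrm{rowword}(T))=T$. Knuth transformations are the usual elementary Knuth relations on words. Cocharge labeling: the cocharge labeling $w^{\mathrm{cc}}$ of a standard word $w$ is the word of the same length obtained by labeling the numbers of $w$ in increasing order: $1$ is labeled $0$, and if $i$ is labeled $k$, then $i+1$ is labeled $k$ (resp. $k+1$) if $i+1$ appears to the right (resp. left) of $i$ in $w$; the label of $w_j$ is placed in position $j$. Corotation: for a word $w$ and a number $a\neq 1$ such that $wa$ is a standard word, $aw$ is a corotation of $wa$; it is a non-zero corotation if $a$ is labeled by a number greater than $0$ in the cocharge labeling of $wa$. Catabolism transformation: for a standard word $w$ with cocharge labeling $z=w^{\mathrm{cc}}$ and an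 index $i$ with $|z_i-z_{i+1}|>1$, the operation replacing $w$ by the word obtained by swapping the entries in positions $i$ and $i+1$. For a partition $\nu$, $Z_\nu$ is the (superstandard) tableau of shape $\nu$ with $0$'s in the first row, $1$'s in the second row, etc. Catabolism insertion algorithm: let $\epsilon_i$ be the standard basis vector with $1$ in coordinate $i$ (partitions are regarded as vectors padded with zeros). For a nonempty word $x=ya$ with last letter $a$ (a nonnegative integer) and a partition $\nu$, set $$f(ya,\nu)=\begin{cases}(y,\ \nu+\epsilon_{a+1}) & \text{if } \nu+\epsilon_{a+1}\text{ is a partition},\\ ((a+1)\,y,\ \nu) & \text{otherwise,}\end{cases}$$ where $(a+1)\,y$ is the word consisting of the letter $a+1$ followed by $y$. Given a standard word $w$, start with $(w^{\mathrm{cc}},\emptyset)$ and apply $f$ repeatedly, stopping when the word of the pair is empty. Each application of $f$ is a step. The partition of the final pair is the output, denoted $F(w)$. Catabolizability: for a tableau $T$ with distinct entries and with at least $m$ squares in its first row, $T_{(m)}$ is the subtableau formed by the first $m$ squares of the first row, and the $m$-catabolism is $\mathrm{cat}_m(T)=P(\mathrm{rowword}(T_n)\,\mathrm{rowword}(T_s))$, where $T_n$ is the first row of $T$ with $T_{(m)}$ removed and $T_s$ consists of the remaining rows of $T$. For a partition $\lambda$ of $|T|$ (the number of squares of $T$), $T$ is $\lambda$-catabolizable if its first row has at least $\lambda_1$ squares, $T_{(\lambda_1)}$ contains the $\lambda_1$ smallest entries of $T$, and $\mathrm{cat}_{\lambda_1}(T)$ is $\widehat\lambda$-catabolizable, where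 $\lambda=(\lambda_1,\widehat\lambda)$; the empty tableau is $\varnothing$-catabolizable. For a standard Young tableau $T$ there is a unique maximal (in dominance order) partition $\lambda$ such that $T$ is $\lambda$-catabolizable (a known fact); this $\lambda$ is the catabolizability $\mathrm{ctype}(T)$ of $T$. It is also obtained by repeatedly applying $\mathrm{cat}_m$ with the largest $m$ such that the first $m$ entries of the first row are the $m$ smallest entries of the current tableau, and recording the successive values of $m$. *)

(* Defs.v *)
From mathcomp Require Import all_boot ssrint.
From mathcomp Require Import boolp classical_sets.

Set Implicit Arguments.
Unset Strict Implicit.
Unset Printing Implicit Defensive.

Local Open Scope nat_scope.

(** Words and cocharge labeling. *)

Definition word := seq nat.

Definition standard (w : word) : bool := perm_eq w (iota 1 (size w)).

(* The label of the number i in the standard word w; i = 0 does not occur in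
   standard words and its label is junk. *)
Fixpoint cc_label (w : word) (i : nat) : nat :=
  match i with
  | 0 => 0
  | j.+1 =>
      if j == 0 then 0
      else if index j w < index j.+1 w then cc_label w j
      else (cc_label w j).+1
  end.

Definition cocharge_labeling (w : word) : word := [seq cc_label w i | i <- w].

(** Transformations of words. *)

Definition nonzero_corotation (u v : word) : Prop :=
  exists (w : word) (a : nat),
    [/\ u = rcons w a, v = a :: w, standard u, a != 1 & 0 < cc_label u a].

Definition swap_adjacent (i : nat) (w : word) : word :=
  set_nth 0 (set_nth 0 w i (nth 0 w i.+1)) i.+1 (nth 0 w i).

Definition catabolism_transformation (u v : word) : Prop :=
  let z := cocharge_labeling u in
  exists i : nat,
    [/\ i.+1 < size u, 1 < `|nth 0 z i - nth 0 z i.+1|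
      & v = swap_adjacent i u].

Inductive elementary_knuth : word -> word -> Prop :=
| Knuth1 (p s : word) (x y z : nat) of x < y & y <= z :
    elementary_knuth (p ++ [:: y; z; x] ++ s) (p ++ [:: y; x; z] ++ s)
| Knuth2 (p s : word) (x y z : nat) of x <= y & y < z :
    elementary_knuth (p ++ [:: x; z; y] ++ s) (p ++ [:: z; x; y] ++ s).

Definition knuth_transformation (u v : word) : Prop :=
  elementary_knuth u v \/ elementary_knuth v u.

(** Tableaux: the sequence of rows, from north to south. *)

Definition tableau := seq word.

Definition rowword (T : tableau) : word := flatten (rev T).

(* Row insertion: the new row, and the bumped entry if there is one. *)
Fixpoint insert_row (r : word) (a : nat) : word * option nat :=
  match r with
  | [::] => ([:: a], None)
  | b :: r' =>
      if a < b then (a :: r', Some b)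
      else let: (r'', o) := insert_row r' a in (b :: r'', o)
  end.

Fixpoint insert_tableau (T : tableau) (a : nat) : tableau :=
  match T with
  | [::] => [:: [:: a]]
  | r :: T' =>
      match insert_row r a with
      | (r', None) => r' :: T'
      | (r', Some b) => r' :: insert_tableau T' b
      end
  end.

Definition insertion_tableau (w : word) : tableau :=
  foldl insert_tableau [::] w.

(** Partitions: weakly decreasing sequences of positive integers. *)

Definition is_partition (nu : seq nat) : bool := sorted geq nu && (0 \notin nu).

Definition partition_of (n : nat) (nu : seq nat) : bool :=
  is_partition nu && (sumn nu == n).

Definition dominated (mu la : seq nat) : Prop :=
  forall k : nat, sumn (take k mu) <= sumn (take k la).

Definition superstandard (nu : seq nat) : tableau :=
  mkseq (fun i => nseq (nth 0 nu i) i) (size nu).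

(** Catabolism insertion. *)

(* [incr_nth nu a] is nu + epsilon_(a+1), with zeros inserted in the gap if
   there is one, in which case it is not a partition.  On an empty word the
   algorithm has stopped, and the pair no longer changes. *)
Definition catins_step (p : word * seq nat) : word * seq nat :=
  match p with
  | ([::], nu) => ([::], nu)
  | (b :: s, nu) =>
      let a := last b s in
      let y := belast b s in
      if is_partition (incr_nth nu a) then (y, incr_nth nu a)
      else (a.+1 :: y, nu)
  end.

Definition catins_state (w : word) (k : nat) : word * seq nat :=
  iter k catins_step (cocharge_labeling w, [::]).

(* The output of the algorithm; [::] by convention if it does not terminate. *)
Definition catins_output (w : word) : seq nat :=
  xget [::] (fun nu => exists k : nat, catins_state w k = ([::], nu)).

(** Catabolizability. *)

(* T_n is the first row without its first m entries; T_s is the other rows. *)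
Definition catabolism (m : nat) (T : tableau) : tableau :=
  insertion_tableau (drop m (head [::] T) ++ rowword (behead T)).

Definition smallest_entries (m : nat) (T : tableau) : seq nat :=
  take m (sort leq (rowword T)).

(* The first m entries of the first row R are those of T_(m). *)
Fixpoint catabolizable_rec (la : seq nat) (T : tableau) : bool :=
  match la with
  | [::] => T == [::]
  | m :: la' =>
      let R := head [::] T in
      [&& m <= size R, all [in take m R] (smallest_entries m T)
        & catabolizable_rec la' (catabolism m T)]
  end.

Definition catabolizable (la : seq nat) (T : tableau) : bool :=
  partition_of (size (rowword T)) la && catabolizable_rec la T.

Definition maximal_catabolizable (T : tableau) (la : seq nat) : Prop :=
  catabolizable la T /\
  forall mu : seq nat, catabolizable mu T -> dominated la mu -> mu = la.

(* The unique maximal partition; [::] by convention if there is no maximal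
   partition or more than one. *)
Definition ctype (T : tableau) : seq nat :=
  xget [::] (fun la => forall mu, maximal_catabolizable T mu <-> mu = la).

(* Main.v *)
(* Everything happens on label words.  A word is a cocharge labeling iff every
   letter k + 1 occurs in front of some k, and the algorithm keeps this true of
   x rowword(Z_nu); as the letters of the labeling of a word of length n sum up
   to at most C(n, 2), this bounds the number of steps.

   A Knuth transformation of a standard word either swaps two labels that differ
   by more than 1 or, with b = a + 1, exchanges b b a with b a b, or a b a with
   b a a.  If such a pair or triple is at the end of the word, then after two or
   three steps both runs have the same partition and words that are equal or
   again related by such a move, so the outputs agree.

   For the catabolizability, let R be the first row of T and m maximal such that
   R = 1 ... m D.  Corotating D gives D rowword(T_s) 1 ... m, and the algorithm
   inserts 1 ... m in the first row, then runs on the labeling of cat_m(T) with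
   all labels increased by 1.  The first row never stops a letter, because T is
   column strict, so that F(T) = (m, F(cat_m T)).  If p <= m, then cat_p(T) is
   obtained from cat_m(T) by putting p + 1 ... m in front, which adds m - p zeros
   in front of the labeling and m - p squares to the first row of the output.
   Hence (p, F(cat_p T)) is dominated by F(T), and F(T) is maximal. *)

Require Import Defs.
From mathcomp Require Import all_boot.
From mathcomp Require Import ssrint classical_sets zify.

Set Implicit Arguments.
Unset Strict Implicit.
Unset Printing Implicit Defensive.

(** * Partitions and the runs of the algorithm *)

Lemma is_partition_cons p nu :
  is_partition (p :: nu) = [&& 0 < p, nth 0 nu 0 <= p & is_partition nu].
Proof.
rewrite /is_partition inE negb_or /=.
rewrite (eq_sym 0 p) -lt0n.
by case: nu => [|q nu] //=; rewrite andbCA -!andbA.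
Qed.

(** The local form of the partition test: it reads only two rows, so the effect of one insertion on
    another becomes arithmetic. *)
Definition insertable (nu : seq nat) (a : nat) : bool :=
  (a == 0) || (nth 0 nu a < nth 0 nu a.-1).

Lemma is_partition_incr nu a :
  is_partition nu -> is_partition (incr_nth nu a) = insertable nu a.
Proof.
rewrite /insertable; elim: nu a => [|p nu IH] [|a] //.
- by rewrite /= is_partition_cons ltnn nth_nil ltn0.
- by rewrite /= !is_partition_cons => /and3P[_ /leqW -> ->].
rewrite is_partition_cons => /and3P[p0 le_p nuP] /=.
rewrite is_partition_cons p0 nth_incr_nth (IH a nuP) /=.
by case: a => [|a] /=; rewrite ?andbT // add0n le_p.
Qed.

Lemma partition_nth_geq nu i : is_partition nu -> nth 0 nu i.+1 <= nth 0 nu i.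
Proof.
elim: nu i => [|p nu IH] [|i] //; rewrite is_partition_cons => /and3P[_ h /IH].
  by [].
exact.
Qed.

Lemma partition_eq la mu : is_partition la -> is_partition mu ->
  nth 0 la =1 nth 0 mu -> la = mu.
Proof.
elim: la mu => [|p la IH] [|q mu] //; rewrite ?is_partition_cons.
- by move=> _ /and3P[q0 _ _] /(_ 0) /= eq; rewrite -eq in q0.
- by move=> /and3P[p0 _ _] _ /(_ 0) /= eq; rewrite eq in p0.
move=> /and3P[_ _ laP] /and3P[_ _ muP] eq; rewrite (eq 0 : p = q).
by rewrite (IH mu laP muP) // => i; exact: (eq i.+1).
Qed.

(** Partial sums determine the entries, and without trailing zeros the entries determine the
    sequence. *)
Lemma dominated_anti la mu : is_partition la -> is_partition mu ->
  dominated la mu -> dominated mu la -> la = mu.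
Proof.
move=> laP muP le1 le2; apply: partition_eq => // i.
have sum_eq k : sumn (take k la) = sumn (take k mu).
  by apply/eqP; rewrite eqn_leq le1 le2.
have sum_nth s : sumn (take i.+1 s) = sumn (take i s) + nth 0 s i.
  elim: s {sum_eq} i => [|x s IH] [|i] //=; first by rewrite take0 /= addn0 add0n.
  by rewrite -/(take i.+1 s) IH addnA.
by move: (sum_eq i.+1); rewrite !sum_nth sum_eq => /addnI.
Qed.

Lemma sumn_take_incr_nth0 nu k :
  sumn (take k (incr_nth nu 0)) <= (sumn (take k nu)).+1.
Proof. by case: nu k => [|p nu] [|k] //=; case: k. Qed.

Lemma sumn_incr_nth nu a : sumn (incr_nth nu a) = (sumn nu).+1.
Proof.
elim: nu a => [|p nu IH] [|a] //=; last by rewrite IH addnS.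
by rewrite add0n; elim: a.
Qed.

(** * Single steps and halting of the algorithm *)

Lemma catins_step_rcons y a nu : is_partition nu ->
  catins_step (rcons y a, nu) =
    if insertable nu a then (y, incr_nth nu a) else (a.+1 :: y, nu).
Proof.
move=> nuP; rewrite -is_partition_incr //.
by case: y => [|b y] //=; rewrite last_rcons belast_rcons.
Qed.

(** A relation on arbitrary pairs, so that runs can be compared from any point and before
    termination is known. *)
Definition halts (s : word * seq nat) (mu : seq nat) : Prop :=
  exists k, iter k catins_step s = ([::], mu).

Lemma iter_catins_step_nil k mu : iter k catins_step ([::], mu) = ([::], mu).
Proof. exact: iter_fix. Qed.

Lemma haltsS s mu : halts (catins_step s) mu <-> halts s mu.
Proof.
split=> [[k E]|[[|k] E]]; first by exists k.+1; rewrite iterSr.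
  by exists 0; move: E => /= ->.
by exists k; rewrite -iterSr.
Qed.

Lemma halts_fun s mu1 mu2 : halts s mu1 -> halts s mu2 -> mu1 = mu2.
Proof.
move=> [k Ek] [j Ej].
have: iter (k + j) catins_step s = iter (j + k) catins_step s by rewrite addnC.
by rewrite !iterD Ek Ej !iter_catins_step_nil => -[].
Qed.

(** Both runs advance by the same number of steps. Once [R] has been kept beyond step [k], the first
    run rests at [([::], mu)], and [R] forces the second one there too. *)
Lemma halts_bisim (R : word * seq nat -> word * seq nat -> Prop) s t mu :
  (forall s t, R s t ->
     exists i, 0 < i /\ R (iter i catins_step s) (iter i catins_step t)) ->
  (forall t, R ([::], mu) t -> t = ([::], mu)) ->
  R s t -> halts s mu -> halts t mu.
Proof.
move=> stepR nilR Rst [k Ek].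
have [j le_kj Rj] : exists2 j, k <= j & R (iter j catins_step s) (iter j catins_step t).
  elim: k {Ek} => [|k [j le_kj /stepR[i [i0]]]]; first by exists 0.
  by rewrite -!iterD => Rij; exists (i + j) => //; lia.
exists j; apply: nilR; move: Rj.
by rewrite -{1}(subnK le_kj) iterD Ek iter_catins_step_nil.
Qed.

Lemma catins_output_halts w mu :
  halts (cocharge_labeling w, [::]) mu -> catins_output w = mu.
Proof.
by move=> h; apply: xget_unique => // nu hnu; exact: halts_fun hnu h.
Qed.

(** * Moves on label words *)

(** [LabelRefl] is present because related runs may merge. One direction of each move is enough,
    since equality of outputs is symmetric. *)
Inductive label_move : word -> word -> Prop :=
| LabelRefl z : label_move z z
| LabelSwap p s a b of (a.+1 < b) || (b.+1 < a) :
    label_move (p ++ [:: a; b] ++ s) (p ++ [:: b; a] ++ s)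
| LabelKnuth1 p s a :
    label_move (p ++ [:: a.+1; a.+1; a] ++ s) (p ++ [:: a.+1; a; a.+1] ++ s)
| LabelKnuth2 p s a :
    label_move (p ++ [:: a; a.+1; a] ++ s) (p ++ [:: a.+1; a; a] ++ s).

Lemma label_move_cons c y z : label_move y z -> label_move (c :: y) (c :: z).
Proof.
case=> [{}y|p s a b|p s a|p s a]; rewrite -?cat_cons; by constructor.
Qed.

Definition state_move (s t : word * seq nat) : Prop :=
  [/\ label_move s.1 t.1, is_partition s.2 & s.2 = t.2].

Lemma state_move_rcons y z c nu : label_move y z -> is_partition nu ->
  state_move (catins_step (rcons y c, nu)) (catins_step (rcons z c, nu)).
Proof.
move=> yz nuP; rewrite !catins_step_rcons //.
case: ifP => ins; split => //=; last exact: label_move_cons.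
by rewrite is_partition_incr.
Qed.

Ltac run_catins :=
  rewrite -?rcons_cons catins_step_rcons //;
  match goal with |- context [if insertable ?mu ?a then _ else _] =>
    let h := fresh "ins" in
    let p := fresh "incrP" in
    destruct (insertable mu a) eqn:h;
    [have p : is_partition (incr_nth mu a) by rewrite is_partition_incr|]
  end.

Ltac insertable_absurd :=
  exfalso;
  repeat match goal with H : is_true (is_partition _) |- _ => clear H end;
  repeat match goal with H : insertable _ _ = _ |- _ =>
    rewrite /insertable ?nth_incr_nth /= in H end;
  lia.

(** One step is enough while both words end in the same untouched letter; a swap at the end takes
    two steps and a triple takes three. *)
Lemma state_move_step s t : state_move s t ->
  exists i, 0 < i /\ state_move (iter i catins_step s) (iter i catins_step t).
Proof.
case: s t => [y nu] [z _] [/= yz nuP <-].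
have le_a a := partition_nth_geq a nuP.
case: {y z} yz => [z|p s a b ab|p s a|p s a].
- exists 1; split=> //=; case/lastP: z => [|z c]; first by split=> //; constructor.
  by apply: state_move_rcons => //; constructor.
- case/lastP: s => [|s c]; last first.
    exists 1; rewrite -!rcons_cat; split=> //.
    by apply: state_move_rcons => //; constructor.
  (* Inserting [c] changes neither row [d] nor the row above it, so the two insertions do not
     interfere. *)
  have insP mu c d : (c.+1 < d) || (d.+1 < c) ->
      insertable (incr_nth mu c) d = insertable mu d.
    by rewrite /insertable !nth_incr_nth; lia.
  have ba : (b.+1 < a) || (a.+1 < b) by rewrite orbC.
  exists 2; split => //; rewrite !cats0.
  rewrite -[[:: a; b]]/(rcons [:: a] b) -[[:: b; a]]/(rcons [:: b] a).
  rewrite -!rcons_cat !cats1 -![iter 2 _ _]/(catins_step (catins_step _)).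
  do 4!run_catins;
    repeat match goal with H : _ |- _ => rewrite insP // in H end; try congruence;
    split => //=; try (exact: incr_nthC); try exact: LabelRefl.
  (* Both letters were rejected: they return to the front raised by 1 and still form a swap. *)
  exact: (@LabelSwap [::] p a.+1 b.+1).
- case/lastP: s => [|s c]; last first.
    exists 1; rewrite -!rcons_cat; split=> //.
    by apply: state_move_rcons => //; constructor.
  exists 3; split => //; rewrite !cats0.
  rewrite -[[:: a.+1; a.+1; a]]/(rcons (rcons [:: a.+1] a.+1) a).
  rewrite -[[:: a.+1; a; a.+1]]/(rcons (rcons [:: a.+1] a) a.+1).
  rewrite -!rcons_cat !cats1 -![iter 3 _ _]/(catins_step (catins_step (catins_step _))).
  (* The partition decreases weakly around row [a], which rules out the impossible combinations of
     the six insertion tests. *)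
  have := le_a a; have := le_a a.-1; clear le_a => le1 le2.
  do 6!run_catins; try insertable_absurd; split => //=;
    try exact: LabelRefl; try by rewrite (incr_nthC nu a.+1 a).
  (* All three letters were rejected in both runs. *)
  exact: (@LabelKnuth1 [::] p a.+1).
- case/lastP: s => [|s c]; last first.
    exists 1; rewrite -!rcons_cat; split=> //.
    by apply: state_move_rcons => //; constructor.
  exists 3; split => //; rewrite !cats0.
  rewrite -[[:: a; a.+1; a]]/(rcons (rcons [:: a] a.+1) a).
  rewrite -[[:: a.+1; a; a]]/(rcons (rcons [:: a.+1] a) a).
  rewrite -!rcons_cat !cats1 -![iter 3 _ _]/(catins_step (catins_step (catins_step _))).
  have := le_a a; have := le_a a.-1; clear le_a => le1 le2.
  do 6!run_catins; try insertable_absurd; split => //=;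
    try exact: LabelRefl; try by rewrite (incr_nthC _ a.+1 a).
  exact: (@LabelKnuth2 [::] p a.+1).
Qed.

Lemma label_move_halts y z nu mu : is_partition nu -> label_move y z ->
  halts (y, nu) mu -> halts (z, nu) mu.
Proof.
move=> nuP yz; apply: (halts_bisim state_move_step); last by split.
move=> [x la] [/= nil_x _ <-]; congr pair.
by move En : [::] nil_x => n nil_x; case: nil_x En => //; case.
Qed.

(** * Cocharge labels *)

Lemma mem_standard w i : standard w -> (i \in w) = (0 < i <= size w).
Proof. by move=> /perm_mem ->; rewrite mem_iota add1n ltnS. Qed.

Lemma standard_uniq w : standard w -> uniq w.
Proof. by move=> /perm_uniq ->; rewrite iota_uniq. Qed.

Lemma standard_perm u v : perm_eq u v -> standard u -> standard v.
Proof.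
move=> uv; rewrite /standard -(perm_size uv) => stdu.
by rewrite -(permPl uv).
Qed.

Lemma cc_labelS w j : 0 < j ->
  cc_label w j.+1 = cc_label w j + (index j.+1 w <= index j w).
Proof. by case: j => // j _ /=; case: leqP => //=; rewrite ?addn0 ?addn1. Qed.

Lemma cc_label1 w : cc_label w 1 = 0. Proof. by []. Qed.

(** Passing from a number to the next either keeps the label and moves right, or raises it. Equal
    labels at both ends exclude every rise. *)
Lemma cc_label_mono w i j : 0 < i <= j ->
  cc_label w i <= cc_label w j /\
  (cc_label w i = cc_label w j -> index i w <= index j w).
Proof.
move=> /andP[i0]; elim: j => [|j IH]; first by rewrite leqNgt i0.
rewrite leq_eqVlt => /predU1P[-> //|]; rewrite ltnS => le_ij.
have [le1 idx] := IH le_ij; rewrite cc_labelS; last exact: leq_trans le_ij.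
by split=> [|eq]; lia.
Qed.

(** Labels depend only on the relative order of consecutive numbers, so a shifted copy of [v] has
    the same increments, starting from the label of [m + 1]. *)
Lemma cc_label_shift (u v : word) m N :
  (forall j, 0 < j < N -> (index (m + j) u < index (m + j).+1 u) =
                          (index j v < index j.+1 v)) ->
  forall i, 0 < i <= N -> cc_label u (m + i) = cc_label u m.+1 + cc_label v i.
Proof.
move=> idx; elim=> // -[|i] IH lt_iN; first by rewrite addn1 addn0.
rewrite (addnS m i.+1) cc_labelS; last by rewrite addnS.
rewrite IH; last by lia.
rewrite (@cc_labelS v i.+1) //.
have := idx i.+1; lia.
Qed.

Lemma eq_cc_label (u v : word) :
  (forall j, 0 < j -> (index j u < index j.+1 u) = (index j v < index j.+1 v)) ->
  cc_label u =1 cc_label v.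
Proof.
move=> idx [|i] //; have := @cc_label_shift u v 0 i.+1 _ i.+1.
rewrite add0n cc_label1; apply; last by lia.
by move=> j /andP[j0 _]; rewrite add0n idx.
Qed.

Lemma cc_label_swap (p s : word) (a b : nat) : a.+1 != b -> b.+1 != a ->
  cc_label (p ++ [:: a; b] ++ s) =1 cc_label (p ++ [:: b; a] ++ s).
Proof.
move=> ab ba; apply: eq_cc_label => j j0; rewrite !(index_cat _ p) /=.
have lt_size i : (index i p < size p) = (i \in p) by exact: index_mem.
case: (boolP (j \in p)) (lt_size j) => [jp|jp] ltj;
  case: (boolP (j.+1 \in p)) (lt_size j.+1) => [Sp|Sp] ltS; try lia;
  repeat (case: ifP => /eqP ?); lia.
Qed.

Lemma cc_label_lt w i : 0 < i -> cc_label w i < i.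
Proof. by elim: i => // -[|i] IH _ //; rewrite cc_labelS //; move: (IH isT); lia. Qed.

(** In front, [a] is left of [a - 1] instead of right of it, which raises its label by 1. Then
    [a + 1] is right of [a] instead of left of it, which cancels the rise for all larger numbers. *)
Lemma cc_label_corotation w a i : standard (rcons w a) -> a != 1 ->
  0 < i <= (size w).+1 ->
  cc_label (a :: w) i = cc_label (rcons w a) i + (i == a).
Proof.
move=> std a1; have := standard_uniq std; rewrite rcons_uniq => /andP[aw _].
have memw j : 0 < j <= (size w).+1 -> j != a -> j \in w.
  by have := mem_standard j std; rewrite mem_rcons inE size_rcons => <- /orP[->|].
elim: i => // -[|i] IH le_i; first by rewrite !cc_label1 eq_sym (negbTE a1).
rewrite !(@cc_labelS _ i.+1) // IH; last by lia.
have ltw j : j \in w -> index j w < size w by rewrite index_mem.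
rewrite -cats1 !index_cat /= !(eq_sym a).
have [eqa|nea] := eqVneq i.+1 a; have [eqa'|nea'] := eqVneq i.+2 a; try lia.
- have := memw i.+2; rewrite nea' => Sw.
  have {}Sw : i.+2 \in w by apply: Sw => //; lia.
  have aw' : (i.+1 \in w) = false by rewrite eqa (negbTE aw).
  have := ltw _ Sw; rewrite Sw aw'; lia.
- have Sw : i.+1 \in w by apply: memw => //; lia.
  have aw' : (i.+2 \in w) = false by rewrite eqa' (negbTE aw).
  have := ltw _ Sw; rewrite Sw aw'; lia.
- by rewrite !memw //; lia.
Qed.

Lemma cocharge_labeling_corotation w a : standard (rcons w a) -> a != 1 ->
  exists2 y, cocharge_labeling (rcons w a) = rcons y (cc_label (rcons w a) a)
    & cocharge_labeling (a :: w) = (cc_label (rcons w a) a).+1 :: y.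
Proof.
move=> std a1; exists [seq cc_label (rcons w a) i | i <- w].
  by rewrite /cocharge_labeling map_rcons.
have memP i : i \in rcons w a -> 0 < i <= (size w).+1.
  by rewrite (mem_standard _ std) size_rcons.
rewrite /cocharge_labeling map_cons cc_label_corotation //; last first.
  by apply: memP; rewrite mem_rcons mem_head.
rewrite eqxx addn1; congr cons; apply/eq_in_map => i iw.
rewrite cc_label_corotation //; last by apply: memP; rewrite mem_rcons inE iw orbT.
case: eqP => [eq|]; rewrite ?addn0 //.
by have := standard_uniq std; rewrite rcons_uniq -eq iw.
Qed.

(** The intrinsic description of cocharge labelings; the two directions are [cocharge_labelingP] and
    [cocharge_labeling_standardization]. [mem2] asks for a [k] behind the first [k + 1]. *)
Definition cocharge_word (z : word) : Prop :=
  forall k, k.+1 \in z -> mem2 z k.+1 k.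

Lemma mem2_index (T : eqType) (s : seq T) x y :
  y \in s -> index x s <= index y s -> mem2 s x y.
Proof.
rewrite /mem2 -{1}(cat_take_drop (index x s) s) mem_cat => /orP[/index_ltn|//].
by rewrite ltnNge => /negPf ->.
Qed.

Lemma mem2_map (T1 T2 : eqType) (f : T1 -> T2) s x y :
  mem2 s x y -> mem2 (map f s) (f x) (f y).
Proof.
elim: s => // a s IH; rewrite mem2_cons /= mem2_cons.
case: (eqVneq a x) => [-> ysx|_ /IH h]; first by rewrite eqxx -map_cons map_f.
by case: ifP => // _; rewrite inE (mem2r h) orbT.
Qed.

(** Descend from a number labeled [k + 1] until the label drops: the least such number stands left
    of its predecessor, which is labeled [k]. *)
Lemma cocharge_labelingP v : standard v -> cocharge_word (cocharge_labeling v).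
Proof.
move=> std k /mapP[i iv] /esym; elim: i iv => // -[|i] // IH iv.
rewrite cc_labelS //.
have iv' : i.+1 \in v by move: iv; rewrite !(mem_standard _ std); lia.
case: leqP => [le_idx|_]; last by rewrite addn0; exact: IH.
rewrite addn1 => /eqP; rewrite eqSS => /eqP eqk.
have -> : k.+1 = cc_label v i.+2 by rewrite cc_labelS // le_idx eqk addn1.
by rewrite -eqk; apply/mem2_map/mem2_index.
Qed.

(** * Standardization and the invariants of a run *)

Definition lex_pos (z : word) : rel nat :=
  fun i j => (nth 0 z i < nth 0 z j) || ((nth 0 z i == nth 0 z j) && (i <= j)).

Definition label_order (z : word) : seq nat := sort (lex_pos z) (iota 0 (size z)).

(* Position i receives the rank of the pair (z_i, i). *)
Definition standardization (z : word) : word :=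
  mkseq (fun i => (index i (label_order z)).+1) (size z).

Section Standardization.

Variable z : word.

Let L := label_order z.

Lemma mem_label_order i : (i \in L) = (i < size z).
Proof. by rewrite mem_sort mem_iota. Qed.

Lemma size_label_order : size L = size z.
Proof. by rewrite size_sort size_iota. Qed.

Lemma label_order_uniq : uniq L.
Proof. by rewrite sort_uniq iota_uniq. Qed.

Lemma label_order_lex i j : i <= j < size z -> lex_pos z (nth 0 L i) (nth 0 L j).
Proof.
move=> /andP[le_ij ltj].
have tr : transitive (lex_pos z) by rewrite /lex_pos => y x t; lia.
have rf : reflexive (lex_pos z) by rewrite /lex_pos => x; lia.
have tot : total (lex_pos z) by rewrite /lex_pos => x y; lia.
apply: (sorted_leq_nth tr rf) => //; rewrite ?inE ?size_label_order //.
  exact: sort_sorted.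
exact: leq_ltn_trans ltj.
Qed.

Lemma standardization_standard : standard (standardization z).
Proof.
rewrite /standard /standardization size_mkseq /mkseq.
have -> : iota 1 (size z) = [seq (index i L).+1 | i <- L].
  apply: (@eq_from_nth _ 0) => [|i]; first by rewrite size_map size_iota size_label_order.
  rewrite size_iota => lti; rewrite nth_iota // (nth_map 0) ?size_label_order //.
  by rewrite index_uniq ?size_label_order // label_order_uniq.
by rewrite perm_map // perm_sym perm_sort.
Qed.

Lemma index_standardization t : t < size z ->
  index t.+1 (standardization z) = nth 0 L t.
Proof.
move=> ltt; set p := nth 0 L t.
have ltp : p < size z by rewrite -mem_label_order mem_nth ?size_label_order.
have -> : t.+1 = nth 0 (standardization z) p.
  by rewrite nth_mkseq // index_uniq ?size_label_order // label_order_uniq.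
by rewrite index_uniq ?size_mkseq ?standard_uniq // standardization_standard.
Qed.

(** Induction on the rank, comparing positions [p] and [q] that are consecutive in the order. With
    equal letters [q] is right of [p] and the label stays; otherwise the letter must rise by exactly
    1 with [q] left of [p]. *)
Lemma cc_label_standardization t : cocharge_word z -> t < size z ->
  cc_label (standardization z) t.+1 = nth 0 z (nth 0 L t).
Proof.
move=> zP; elim: t => [|t IH] ltt.
  (* The least letter is 0, since a letter [k + 1] would entail the smaller letter [k]. *)
  rewrite cc_label1; case E: (nth 0 z (nth 0 L 0)) => [//|k].
  have ltp : nth 0 L 0 < size z.
    by rewrite -mem_label_order mem_nth ?size_label_order.
  have : mem2 z k.+1 k by apply: zP; rewrite -E mem_nth.
  move=> /mem2r kz; have ltq : index k z < size z by rewrite index_mem.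
  have := @label_order_lex 0 (index (index k z) L).
  rewrite nth_index ?mem_label_order // /lex_pos E nth_index //.
  have : index (index k z) L < size z.
    by rewrite -size_label_order index_mem mem_label_order.
  lia.
have lttS := ltnW ltt.
rewrite cc_labelS // IH // !index_standardization //.
set p := nth 0 L t; set q := nth 0 L t.+1.
have lex_pq : lex_pos z p q by apply: label_order_lex; rewrite leqnSn.
have neq_pq : p != q.
  by rewrite nth_uniq ?size_label_order ?label_order_uniq // neq_ltn leqnn.
have split_pq r : r < size z -> lex_pos z r p || lex_pos z q r.
  rewrite -mem_label_order => rL; rewrite -(nth_index 0 rL).
  have lt_r : index r L < size z by rewrite -size_label_order index_mem.
  have [le_rt|lt_tr] := leqP (index r L) t.
    by rewrite label_order_lex // le_rt.
  by rewrite orbC label_order_lex // lt_tr.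
have ltq : q < size z by rewrite -mem_label_order mem_nth ?size_label_order.
have [eqz|neqz] := eqVneq (nth 0 z p) (nth 0 z q).
  by move: lex_pq; rewrite /lex_pos; lia.
case Eq: (nth 0 z q) => [|k]; first by move: lex_pq; rewrite /lex_pos; lia.
have kz : mem2 z k.+1 k by apply: zP; rewrite -Eq mem_nth.
(* Position [i] holds a [k + 1] and position [i + j'] a later [k]. As nothing lies strictly between
   [p] and [q] in the order, [p] holds [k] and [q <= i < i + j' <= p]. *)
pose i := index k.+1 z.
have /(nthP 0)[j' ltj Ej] : k \in drop i z := kz.
rewrite size_drop ltn_subRL in ltj; rewrite nth_drop in Ej.
have Ei : nth 0 z i = k.+1 by rewrite nth_index // (mem2l kz).
have lti : i < size z by rewrite index_mem (mem2l kz).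
have j'0 : 0 < j' by case: j' Ej {ltj} => //; rewrite addn0 Ei; lia.
have := split_pq i lti; have := split_pq (i + j') ltj; move: lex_pq.
rewrite /lex_pos Ei Ej Eq; lia.
Qed.

Lemma cocharge_labeling_standardization : cocharge_word z ->
  cocharge_labeling (standardization z) = z.
Proof.
move=> zP; apply: (@eq_from_nth _ 0) => [|i].
  by rewrite size_map size_mkseq.
rewrite size_map size_mkseq => lti.
have iL : i \in L by rewrite mem_label_order.
rewrite (nth_map 0) ?size_mkseq // nth_mkseq // cc_label_standardization //.
  by rewrite nth_index.
by rewrite -size_label_order index_mem.
Qed.

End Standardization.

(** * Row words of superstandard tableaux and the validity of states *)

Definition superword (nu : seq nat) : word := rowword (superstandard nu).

Lemma superword_rcons nu c : superword (rcons nu c) = nseq c (size nu) ++ superword nu.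
Proof.
rewrite /superword /rowword /superstandard size_rcons.
rewrite /mkseq -addn1 iotaD map_cat rev_cat flatten_cat add0n /= cats0.
rewrite nth_rcons ltnn eqxx; congr (_ ++ flatten (rev _)).
by apply/eq_in_map => i; rewrite mem_iota nth_rcons => /andP[_ ->].
Qed.

Lemma count_superword (nu : seq nat) (k : nat) : count_mem k (superword nu) = nth 0 nu k.
Proof.
elim/last_ind: nu => [|nu c IH]; first by rewrite nth_nil.
rewrite superword_rcons count_cat IH count_nseq nth_rcons /=.
by case: (ltngtP k (size nu)) => [//|lt|->]; rewrite nth_default ?addn0 ?mul1n // ltnW.
Qed.

Lemma mem_superword nu k : (k \in superword nu) = (0 < nth 0 nu k).
Proof. by rewrite -count_superword -has_pred1 has_count. Qed.

Lemma mem2_superword nu k : 0 < nth 0 nu k -> 0 < nth 0 nu k.+1 ->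
  mem2 (superword nu) k.+1 k.
Proof.
elim/last_ind: nu => [|nu c IH]; first by rewrite nth_nil.
rewrite superword_rcons mem2_cat !nth_rcons !mem_superword.
case: (ltngtP k.+1 (size nu)) => [lt|gt|eq]; rewrite ?ltnn //.
  by move=> h1 h2; rewrite IH ?orbT.
by move=> -> c0; rewrite -eq mem_nseq c0 eqxx !orbT.
Qed.

Lemma perm_superword_incr nu a : perm_eq (superword (incr_nth nu a)) (a :: superword nu).
Proof.
apply/allP => k _ /=; rewrite !count_superword nth_incr_nth; exact/eqP.
Qed.

Lemma size_superword nu : size (superword nu) = sumn nu.
Proof.
elim/last_ind: nu => // nu c IH.
by rewrite superword_rcons size_cat size_nseq IH sumn_rcons addnC.
Qed.

Definition valid_state (s : word * seq nat) : Prop :=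
  is_partition s.2 /\ cocharge_word (s.1 ++ superword s.2).

Lemma mem2_seq1_succ (a k : nat) : mem2 [:: a] k.+1 k = false.
Proof. by rewrite mem2_cons; case: eqP => // ->; rewrite inE ltn_eqF. Qed.

(** An inserted [a] only moves to the right into its row, behind all larger letters of
    [superword nu]. For a rejected [a], the failed test supplies the letters that are needed behind
    the others. *)
Lemma valid_state_step s : valid_state s -> valid_state (catins_step s).
Proof.
case: s => y nu; case/lastP: y => [//|y a] [nuP zP].
rewrite /= in nuP zP; rewrite catins_step_rcons //; rewrite -cats1 -catA in zP.
have {}zP k : k.+1 \in y ++ [:: a] ++ superword nu ->
    [\/ mem2 y k.+1 k, k.+1 \in y /\ k \in a :: superword nu
      | k.+1 \in a :: superword nu /\ k \in superword nu].
  move=> /zP; rewrite !mem2_cat mem2_seq1_succ.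
  case/orP => [/orP[->|/orP[h|/andP[]]]|/andP[]]; first by constructor 1.
  - by constructor 3; rewrite inE (mem2l h) (mem2r h) orbT.
  - by rewrite inE => /eqP -> ->; constructor 3; rewrite mem_head.
  - by constructor 2.
have := @is_partition_incr nu a nuP.
case: ifP => ins nuP'; split=> //= k.
  have memR j : (j \in superword (incr_nth nu a)) = (j \in a :: superword nu).
    exact: (perm_mem (perm_superword_incr nu a)).
  rewrite mem_cat mem2_cat => kz.
  have {kz}/zP[->//|[ky ka]|[Sk k_in]] : k.+1 \in y ++ [:: a] ++ superword nu.
    by rewrite mem_cat -memR.
  - by rewrite ky memR ka !orbT.
  - rewrite mem2_superword ?orbT // -mem_superword memR //.
    by rewrite inE k_in orbT.
(* Rejection means that row [a - 1] is no longer than row [a], so a letter [a - 1] in [superword nu]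
   comes with a letter [a]. *)
have [a0 le_nu] : 0 < a /\ nth 0 nu a.-1 <= nth 0 nu a.
  by move: ins; rewrite /insertable; case: a {zP nuP'} => //= a /negbT; rewrite -leqNgt.
(* The new [a + 1] in front needs some other [a]; it is found by applying the old condition to the
   removed [a]. *)
rewrite mem2_cons; case: eqP => [[<-] _|neq].
  rewrite inE.
  have /zP : a.-1.+1 \in y ++ [:: a] ++ superword nu.
    by rewrite prednK // mem_cat mem_head orbT.
  rewrite prednK // mem_cat => -[/mem2l ->|[-> _]|[_]]; rewrite ?orbT //.
  by rewrite !mem_superword => /leq_trans/(_ le_nu) ->; rewrite !orbT.
rewrite inE eq_sym => /predU1P[//|kz].
have {kz}/zP[h|[ky]|[]] : k.+1 \in y ++ [:: a] ++ superword nu.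
- by rewrite !mem_cat; move: kz; rewrite mem_cat => /orP[] ->; rewrite ?orbT.
- by rewrite mem2_cat h.
- rewrite inE mem2_cat ky => /predU1P[eq|->]; last by rewrite orbT.
  by case: neq; rewrite eq.
- rewrite inE mem2_cat !mem_superword => /predU1P[eq|h1] h2.
    by move: le_nu; rewrite -eq /= => /(leq_trans h2) h1; rewrite mem2_superword ?orbT.
  by rewrite mem2_superword ?orbT.
Qed.

Lemma catins_state_valid u k : standard u -> valid_state (catins_state u k).
Proof.
move=> std; elim: k => [|k IH]; last exact: valid_state_step.
by split=> //=; rewrite cats0; exact: cocharge_labelingP.
Qed.

(** * The bound on the number of steps *)

Definition state_size (s : word * seq nat) : nat := size s.1 + sumn s.2.

Lemma state_size_step s : is_partition s.2 -> state_size (catins_step s) = state_size s.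
Proof.
case: s => y nu; case/lastP: y => [//|y a] nuP.
rewrite catins_step_rcons // /state_size size_rcons.
by case: ifP => _ //=; rewrite sumn_incr_nth addnS.
Qed.

Lemma catins_state_size u k : standard u -> state_size (catins_state u k) = size u.
Proof.
move=> std; elim: k => [|k IH]; first by rewrite /state_size addn0 size_map.
by rewrite /catins_state iterS state_size_step ?IH //; have [] := catins_state_valid k std.
Qed.

Lemma sumn_cocharge_labeling v : standard v ->
  sumn (cocharge_labeling v) <= 'C(size v, 2).
Proof.
rewrite /cocharge_labeling /standard => /(perm_map (cc_label v))/perm_sumn ->.
elim: (size v) => // n IH; rewrite -(addn1 n) iotaD map_cat sumn_cat addn1 binS bin1.
rewrite leq_add //; have := @cc_label_lt v n.+1 isT.
by rewrite ltnS -[X in X <= _]addn0.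
Qed.

Lemma catins_state_labeling u k : standard u ->
  let s := catins_state u k in
  exists v, standard v /\ cocharge_labeling v = s.1 ++ superword s.2.
Proof.
move=> std s; have [_ /cocharge_labeling_standardization eq] := catins_state_valid k std.
by exists (standardization (s.1 ++ superword s.2)); split=> //; exact: standardization_standard.
Qed.

(** A step counter: an insertion keeps the letters and adds a square, a rejection raises one letter
    by 1. *)
Definition state_weight (s : word * seq nat) : nat :=
  sumn (s.1 ++ superword s.2) + sumn s.2.

Lemma state_weight_step s : is_partition s.2 -> s.1 != [::] ->
  state_weight (catins_step s) = (state_weight s).+1.
Proof.
case: s => y nu; case/lastP: y => [//|y a] nuP _.
rewrite catins_step_rcons // /state_weight /= -cats1.
case: ifP => _ /=; last by rewrite !sumn_cat /=; lia.
rewrite sumn_incr_nth !sumn_cat (perm_sumn (perm_superword_incr nu a)) /=; lia.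
Qed.

Lemma catins_state_weight u k : standard u -> (catins_state u k).1 != [::] ->
  k <= state_weight (catins_state u k).
Proof.
move=> std; elim: k => // k IH; have [nuP _] := catins_state_valid k std.
rewrite /catins_state iterS -/(catins_state u k) => ne.
have ne' : (catins_state u k).1 != [::].
  by apply: contraNneq ne; case: (catins_state u k) => y nu /= ->.
by rewrite state_weight_step // ltnS IH.
Qed.

Lemma catins_state_end u : standard u ->
  (catins_state u (size u + 'C(size u, 2))).1 = [::].
Proof.
move=> std; set K := _ + _.
have [//|ne] := eqVneq (catins_state u K).1 [::].
have [v [stdv eqv]] := catins_state_labeling K std.
have size_v : size v = size u.
  rewrite -(catins_state_size K std) /state_size -size_superword -size_cat -eqv.
  by rewrite size_map.
have := sumn_cocharge_labeling stdv; rewrite eqv size_v => le_sum.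
(* Here [a] is the sum of the letters, [b] is [n], [c] is the binomial coefficient, [d] the number
   of squares and [e] the length of the remaining word. *)
have arith (a b c d e : nat) : b + c <= a + d -> a <= c -> e + d = b -> e = 0 by lia.
apply/size0nil/(arith _ _ _ _ _ (catins_state_weight std ne) le_sum).
exact: catins_state_size.
Qed.

(** Every run on a standard word halts, so the default value of [xget] is never taken. *)
Lemma catins_output_halts_iff u mu : standard u ->
  catins_output u = mu <-> halts (cocharge_labeling u, [::]) mu.
Proof.
move=> std; split=> [<-|]; last exact: catins_output_halts.
pose K := size u + 'C(size u, 2).
have h : halts (cocharge_labeling u, [::]) (catins_state u K).2.
  exists K; rewrite -/(catins_state u K).
  by have := catins_state_end std; case: (catins_state u _) => x nu /= ->.
by rewrite (catins_output_halts h).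
Qed.

Lemma catins_output_partition u : standard u -> partition_of (size u) (catins_output u).
Proof.
move=> std; have /(catins_output_halts_iff _ std)[k Ek] := erefl (catins_output u).
have [nuP _] := catins_state_valid k std; have := catins_state_size k std.
rewrite /state_size /catins_state Ek in nuP *.
by move=> <-; rewrite /partition_of nuP /=.
Qed.

(** * Transformations of standard words *)

Lemma distn_gt1 (x y : nat) : 1 < `|x - y| -> x.+1 < y \/ y.+1 < x.
Proof. lia. Qed.

Lemma catins_output_label_move u v : standard u -> standard v ->
  label_move (cocharge_labeling u) (cocharge_labeling v) ->
  catins_output u = catins_output v.
Proof.
move=> stdu stdv uv; apply/esym/catins_output_halts_iff => //.
by apply: label_move_halts uv _ => //; apply/catins_output_halts_iff.
Qed.

(** With the empty partition a nonzero label is rejected, so the first step turns the labeling of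
    [u] into that of [v]. *)
Lemma catins_output_corotation u v : standard u -> nonzero_corotation u v ->
  standard v /\ catins_output u = catins_output v.
Proof.
move=> std [w [a [eu ev _ a1 la]]].
have stdv : standard v.
  by apply: standard_perm std; rewrite eu ev -cats1 -cat1s perm_catC.
split=> //; apply/esym/catins_output_halts_iff => //.
rewrite eu in std la *; have [y eq1 eq2] := cocharge_labeling_corotation std a1.
have := erefl (catins_output (rcons w a)).
rewrite catins_output_halts_iff // eq1 -haltsS catins_step_rcons //.
by rewrite /insertable !nth_nil -leqn0 leqNgt la ev eq2.
Qed.

Lemma cocharge_labeling_swap (p s : word) a b : a.+1 != b -> b.+1 != a ->
  let L := cc_label (p ++ [:: a; b] ++ s) in
  cocharge_labeling (p ++ [:: b; a] ++ s) = map L p ++ [:: L b; L a] ++ map L s.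
Proof.
move=> ab ba L; rewrite /cocharge_labeling -(eq_map (cc_label_swap p s ab ba)).
by rewrite !map_cat.
Qed.

Lemma perm_swap (p s : word) a b : perm_eq (p ++ [:: a; b] ++ s) (p ++ [:: b; a] ++ s).
Proof. by rewrite perm_cat2l perm_cat2r (perm_catC [:: a] [:: b]). Qed.

Lemma swap_adjacent_cat p s a b :
  swap_adjacent (size p) (p ++ [:: a; b] ++ s) = p ++ [:: b; a] ++ s.
Proof. by elim: p => //= c p IH; rewrite -[RHS]/(c :: (p ++ [:: b; a] ++ s)) -IH. Qed.

Lemma catins_output_catabolism_transformation u v : standard u ->
  catabolism_transformation u v -> catins_output u = catins_output v.
Proof.
move=> std [i [lti dz ev]].
have [p [s [a [b [sp eu]]]]] : exists p s a b, size p = i /\ u = p ++ [:: a; b] ++ s.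
  exists (take i u), (drop i.+2 u), (nth 0 u i), (nth 0 u i.+1).
  by rewrite size_takel 1?ltnW 1?ltnW //= -!drop_nth ?cat_take_drop // ltnW.
rewrite -sp eu swap_adjacent_cat in ev; rewrite ev.
have stdv := standard_perm (perm_swap p s a b).
rewrite eu in std dz *; set L := cc_label (p ++ [:: a; b] ++ s).
have cu : cocharge_labeling (p ++ [:: a; b] ++ s) = map L p ++ [:: L a; L b] ++ map L s.
  by rewrite /cocharge_labeling !map_cat.
have {}dz : (L a).+1 < L b \/ (L b).+1 < L a.
  apply: distn_gt1; have lt_p : ((size p).+1 < size p) = false by lia.
  by move: dz; rewrite cu -sp !nth_cat !size_map ltnn subnn /= subSnn lt_p.
have a0 : 0 < a.
  by have := mem_standard a std; rewrite !mem_cat mem_head orbT => /esym/andP[].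
have b0 : 0 < b.
  have := mem_standard b std.
  by rewrite !mem_cat in_cons mem_head !orbT => /esym/andP[].
(* Labels of consecutive numbers differ by at most 1, so [a] and [b] are not consecutive and the
   swap carries their labels along. *)
have ab : a.+1 != b by apply/eqP => eq; move: dz; rewrite -eq /L cc_labelS //; lia.
have ba : b.+1 != a by apply/eqP => eq; move: dz; rewrite -eq /L cc_labelS //; lia.
apply: catins_output_label_move => //; first exact: stdv.
rewrite (cocharge_labeling_swap p s ab ba) cu; apply: LabelSwap; apply/orP; lia.
Qed.

(** The exchanged entries [x] and [z] are not consecutive because [y] lies between them, so each
    number keeps its label. The third entry bounds the labels: [L x < L y <= L z] in the first case,
    [L x <= L y < L z] in the second. If [L z = L x + 1], then [L y] is determined and a Knuth move
    on labels results; otherwise a swap. *)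
Lemma catins_output_elementary_knuth u v : elementary_knuth u v -> standard u ->
  standard v /\ catins_output u = catins_output v.
Proof.
have lab (w : word) (x y : nat) : 0 < x < y -> index y w < index x w ->
    cc_label w x < cc_label w y.
  move=> lt_xy idx; have [|le_l] := @cc_label_mono w x y; first by lia.
  rewrite ltn_neqAle le_l andbT => eq_l; apply/eqP => /eq_l; lia.
have idx2 (p s : word) (x y : nat) : uniq (p ++ s) -> y \in p -> x \in s ->
    index y (p ++ s) < index x (p ++ s).
  rewrite cat_uniq => /and3P[_ /hasPn dis _] yp xs.
  rewrite !index_cat yp (negbTE (dis _ xs)) ltn_addr //.
  by have := index_mem y p; rewrite yp.
case=> p s x y z xy yz std; have uu := standard_uniq std.
- have pos a : a \in [:: y; z; x] -> 0 < a.
    move=> h; have := mem_standard a std.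
    by rewrite mem_cat (mem_cat _ [:: y; z; x]) h orbT => /esym/andP[].
  have neq_yz : y != z.
    by move: uu; rewrite cat_uniq => /and3P[_ _] /=; rewrite inE negb_or => /andP[/andP[]].
  have x0 : 0 < x by apply: pos; rewrite !inE eqxx !orbT.
  have eu : p ++ [:: y; z; x] ++ s = (p ++ [:: y]) ++ [:: z; x] ++ s by rewrite -catA.
  have ev : p ++ [:: y; x; z] ++ s = (p ++ [:: y]) ++ [:: x; z] ++ s by rewrite -catA.
  have stdv : standard (p ++ [:: y; x; z] ++ s).
    by rewrite ev; apply: standard_perm (perm_swap _ _ _ _) _; rewrite -eu.
  split=> //; apply: catins_output_label_move => //.
  have le_yx : cc_label (p ++ [:: y; z; x] ++ s) x < cc_label (p ++ [:: y; z; x] ++ s) y.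
    apply: lab; first by rewrite x0.
    by rewrite eu idx2 -?eu ?mem_cat ?inE ?eqxx ?orbT.
  have [|le_yz _] := @cc_label_mono (p ++ [:: y; z; x] ++ s) y z; first by lia.
  have zx : z.+1 != x by lia.
  have xz : x.+1 != z by lia.
  rewrite ev (cocharge_labeling_swap (p ++ [:: y]) s zx xz) -eu.
  set L := cc_label _ in le_yx le_yz *; rewrite /cocharge_labeling !map_cat -/L /=.
  have [eq|neq] := eqVneq (L z) (L x).+1.
    have -> : L y = L z by lia.
    rewrite eq -catA; exact: LabelKnuth1.
  by rewrite -[_ ++ L y :: _]/(_ ++ [:: L y] ++ [:: L z; L x] ++ _) catA; apply: LabelSwap; lia.
- have pos a : a \in [:: x; z; y] -> 0 < a.
    move=> h; have := mem_standard a std.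
    by rewrite mem_cat (mem_cat _ [:: x; z; y]) h orbT => /esym/andP[].
  have x0 : 0 < x by apply: pos; rewrite mem_head.
  have neq_xy : x != y.
    by move: uu; rewrite cat_uniq => /and3P[_ _] /=; rewrite !inE !negb_or => /andP[/and3P[]].
  have eu : p ++ [:: x; z; y] ++ s = (p ++ [:: x; z]) ++ [:: y] ++ s by rewrite -catA.
  have stdv : standard (p ++ [:: z; x; y] ++ s).
    exact: standard_perm (perm_swap p (y :: s) x z) std.
  split=> //; apply: catins_output_label_move => //.
  have lt_yz : cc_label (p ++ [:: x; z; y] ++ s) y < cc_label (p ++ [:: x; z; y] ++ s) z.
    apply: lab; first by lia.
    by rewrite eu idx2 -?eu ?mem_cat ?inE ?eqxx ?orbT.
  have [|le_xy _] := @cc_label_mono (p ++ [:: x; z; y] ++ s) x y; first by lia.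
  have zx : z.+1 != x by lia.
  have xz : x.+1 != z by lia.
  rewrite (cocharge_labeling_swap p (y :: s) xz zx) -/([:: x; z; y] ++ s).
  set L := cc_label _ in lt_yz le_xy *; rewrite /cocharge_labeling !map_cat -/L /=.
  have [eq|neq] := eqVneq (L z) (L x).+1.
    have -> : L y = L x by lia.
    rewrite eq; exact: LabelKnuth2.
  by apply: LabelSwap; lia.
Qed.

Lemma catins_output_knuth u v : knuth_transformation u v -> standard u ->
  standard v /\ catins_output u = catins_output v.
Proof.
case=> [uv|vu] std; first exact: catins_output_elementary_knuth.
have stdv : standard v.
  apply: standard_perm std; case: vu => p s x y z _ _.
    by have := perm_swap (p ++ [:: y]) s x z; rewrite -!catA.
  exact: (perm_swap p (y :: s)).
by split=> //; have [] := catins_output_elementary_knuth vu stdv.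
Qed.

(** * Row insertion and Knuth equivalence *)

Inductive knuth_equiv : word -> word -> Prop :=
| KnuthRefl u : knuth_equiv u u
| KnuthStep u v w of knuth_transformation u v & knuth_equiv v w : knuth_equiv u w.

Lemma knuth_equiv_trans v u w :
  knuth_equiv u v -> knuth_equiv v w -> knuth_equiv u w.
Proof. by elim=> // {}u u' {}v uu' _ IH /IH; apply: KnuthStep. Qed.

Lemma knuth_equiv_elementary u v : elementary_knuth u v -> knuth_equiv u v.
Proof. by move=> uv; apply: KnuthStep (KnuthRefl v); left. Qed.

Lemma elementary_knuth_context p s u v : elementary_knuth u v ->
  elementary_knuth (p ++ u ++ s) (p ++ v ++ s).
Proof.
by case=> q t x y z xy yz; rewrite -!catA !(catA p q); constructor.
Qed.

Lemma knuth_equiv_context p s u v : knuth_equiv u v ->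
  knuth_equiv (p ++ u ++ s) (p ++ v ++ s).
Proof.
elim=> [{}u|{}u u' {}v uu' _]; first exact: KnuthRefl.
apply: KnuthStep; case: uu' => h; [left|right]; exact: elementary_knuth_context.
Qed.

Lemma catins_output_knuth_equiv u v : knuth_equiv u v -> standard u ->
  standard v /\ catins_output u = catins_output v.
Proof.
elim=> // {}u u' {}v uu' _ IH stdu.
by have [stdu' ->] := catins_output_knuth uu' stdu; exact: IH.
Qed.

Lemma insert_rowE r a : let i := find (ltn a) r in
  insert_row r a = (set_nth 0 r i a, if i < size r then Some (nth 0 r i) else None).
Proof.
elim: r => //= b r IH; case: ltnP => //= _.
by rewrite IH ltnS; case: ltnP.
Qed.

(** The letter [a] passes the entries from right to left, with the left neighbour of the passed
    entry as the witness of each relation. *)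
Lemma knuth_equiv_pass c r a : a < c -> path leq c r ->
  knuth_equiv ((c :: r) ++ [:: a]) [:: c, a & r].
Proof.
elim: r c => [|d r IH] c lt_ac /=; first by move=> _; exact: KnuthRefl.
move=> /andP[le_cd dr]; have := IH d (leq_trans lt_ac le_cd) dr.
move=> /(knuth_equiv_context [:: c] [::]); rewrite !cats0 => h.
apply: knuth_equiv_trans h _; apply: knuth_equiv_elementary.
exact: (@Knuth1 [::] r).
Qed.

(** The second conclusion strengthens the induction: carrying [b] over the next entry [c] needs
    [c <= h < b] for the entry [h] that follows. *)
Lemma knuth_equiv_bump r a r' b : sorted leq r ->
  insert_row r a = (r', Some b) ->
  knuth_equiv (r ++ [:: a]) (b :: r') /\
  exists h t, [/\ r' = h :: t, h < b & h = a \/ h = head a r].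
Proof.
elim: r r' => //= c r IH r' cr; case: ltnP => [lt_ac [<- <-]|le_ca].
  split; last by exists a, r; split=> //; left.
  exact: knuth_equiv_pass.
case E: (insert_row r a) => [r'' o] [<- eo]; rewrite {o}eo in E.
have [eqv [h [t [er lt_hb hP]]]] := IH _ (path_sorted cr) E.
have le_ch : c <= h.
  case: hP => [->//|->]; case: (r) cr => //= d r0 /andP[//].
split; last by exists c, r''; split=> //; [exact: leq_ltn_trans lt_hb|right].
have := knuth_equiv_context [:: c] [::] eqv; rewrite !cats0 => h1.
apply: knuth_equiv_trans h1 _; apply: knuth_equiv_elementary; rewrite er.
exact: (@Knuth2 [::] t).
Qed.

Lemma rowword_cons r T : rowword (r :: T) = rowword T ++ r.
Proof. by rewrite /rowword rev_cons -cats1 flatten_cat /= cats0. Qed.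

Lemma knuth_equiv_insert_tableau T a : all (sorted leq) T ->
  knuth_equiv (rowword T ++ [:: a]) (rowword (insert_tableau T a)).
Proof.
elim: T a => [|r T IH] a /=; first by move=> _; exact: KnuthRefl.
move=> /andP[sr sT]; rewrite rowword_cons -catA.
case E: (insert_row r a) => [r' [b|]]; rewrite rowword_cons.
  have [/(knuth_equiv_context (rowword T) [::]) h _] := knuth_equiv_bump sr E.
  rewrite !cats0 in h; apply: knuth_equiv_trans h _.
  by have := knuth_equiv_context [::] r' (IH b sT); rewrite /= -catA.
suff -> : r' = r ++ [:: a] by exact: KnuthRefl.
move: E; rewrite insert_rowE; case: ltnP => // le_r [<-].
have -> : find (ltn a) r = size r by apply/eqP; rewrite eqn_leq find_size.
by rewrite set_nthE ltnn subnn.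
Qed.

(** * Semistandardness under row insertion *)

Definition column_strict (r s : word) : Prop :=
  size s <= size r /\ forall i, i < size s -> nth 0 r i < nth 0 s i.

Fixpoint semistandard (T : tableau) : Prop :=
  match T with
  | [::] => True
  | r :: T' => [/\ sorted leq r, column_strict r (head [::] T') & semistandard T']
  end.

Lemma semistandard_rows T : semistandard T -> all (sorted leq) T.
Proof. by elim: T => //= r T IH [-> _ /IH]. Qed.

Lemma sorted_insert_row r a : sorted leq r -> sorted leq (insert_row r a).1.
Proof.
rewrite insert_rowE /= => sr; set i := find _ _.
have before j : j < i -> nth 0 r j <= a.
  by move=> /(before_find 0) /= h; rewrite leqNgt h.
have at_i : i < size r -> a < nth 0 r i by rewrite -has_find => /(nth_find 0).
have le_i : i <= size r := find_size _ _.
have {}sr := sorted_leq_nth leq_trans leqnn 0 sr.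
apply/(sortedP 0) => j; rewrite size_set_nth !nth_set_nth /= => ltj.
have [eq1|n1] := eqVneq j i; have [eq2|n2] := eqVneq j.+1 i; try lia.
- have lt : j.+1 < size r by lia.
  apply: leq_trans (sr j j.+1 _ _ _) => //; rewrite ?inE; try lia.
  by rewrite eq1 ltnW // at_i // -eq1; lia.
- by apply: before; lia.
- by apply: sr; rewrite ?inE //; lia.
Qed.

(** The entry [b] bumped from column [i] lands in a column [k <= i], because an entry of [s] in
    column [i] exceeds [b]. Above it stands [a] or an entry that is at most [a]. *)
Lemma column_strict_insert r s a b r' : sorted leq r -> column_strict r s ->
  insert_row r a = (r', Some b) -> column_strict r' (insert_row s b).1.
Proof.
move=> sr [le_sr col]; rewrite !insert_rowE /=; set i := find _ _; set k := find _ _.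
case: ltnP => // lt_i [<- eb].
have before j : j < i -> nth 0 r j <= a.
  by move=> /(before_find 0) /= h; rewrite leqNgt h.
have lt_ab : a < b by rewrite -eb; move: lt_i; rewrite -has_find => /(nth_find 0).
have le_ks : k <= size s := find_size _ _.
have le_ki : k <= i.
  rewrite leqNgt; apply/negP => lt_ik; have := before_find 0 lt_ik => /= /negbT.
  by rewrite -leqNgt -eb leqNgt col //; exact: leq_trans lt_ik _.
split=> [|j]; rewrite !size_set_nth; first by lia.
rewrite !nth_set_nth /= => ltj.
have [eqk|nk] := eqVneq j k; have [eqi|ni] := eqVneq j i; try lia.
- by apply: leq_ltn_trans lt_ab; apply: before; lia.
- by apply: (leq_trans lt_ab); rewrite -eb -eqi ltnW // col //; lia.
- by apply: col; lia.
Qed.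

Lemma head_insert_tableau T a : head [::] (insert_tableau T a) = (insert_row (head [::] T) a).1.
Proof. by case: T => //= r T; case: (insert_row r a) => r' []. Qed.

Lemma semistandard_insert T a : semistandard T -> semistandard (insert_tableau T a).
Proof.
elim: T a => [|r T IH] a /=; first by split.
move=> [sr col sT]; have := sorted_insert_row a sr.
case E: (insert_row r a) => [r' [b|]] /= sr'; split=> //.
- rewrite head_insert_tableau; exact: column_strict_insert E.
- exact: IH.
move: E; rewrite insert_rowE; case: ltnP => // le_r [<-].
have -> : find (ltn a) r = size r by apply/eqP; rewrite eqn_leq find_size.
case: col => le_s col; split; first by rewrite size_set_nth; lia.
by move=> i lti; rewrite nth_set_nth /= ltn_eqF ?col //; lia.
Qed.

Lemma insertion_tableau_rcons w a :
  insertion_tableau (rcons w a) = insert_tableau (insertion_tableau w) a.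
Proof. by rewrite /insertion_tableau -cats1 foldl_cat. Qed.

Lemma semistandard_insertion w : semistandard (insertion_tableau w).
Proof.
elim/last_ind: w => // w a IH; rewrite insertion_tableau_rcons.
exact: semistandard_insert.
Qed.

Lemma knuth_equiv_insertion w : knuth_equiv w (rowword (insertion_tableau w)).
Proof.
elim/last_ind: w => [|w a IH]; first exact: KnuthRefl.
rewrite insertion_tableau_rcons -cats1.
have := knuth_equiv_context [::] [:: a] IH => /= h; apply: knuth_equiv_trans h _.
exact/knuth_equiv_insert_tableau/semistandard_rows/semistandard_insertion.
Qed.

Lemma size_rowword_insertion w : size (rowword (insertion_tableau w)) = size w.
Proof.
have size_eq u v : knuth_equiv u v -> size u = size v.
  by elim=> // {}u z {}v uz _ <-; case: uz; case=> *; rewrite !size_cat.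
by rewrite -(size_eq _ _ (knuth_equiv_insertion w)).
Qed.

Lemma standard_rowword w : standard w -> standard (rowword (insertion_tableau w)).
Proof. by move=> std; have [] := catins_output_knuth_equiv (knuth_equiv_insertion w) std. Qed.

(** * Words with small letters split off *)

(** The two runs could differ only at a letter 0, which becomes 1 and is stopped if the first row of
    [nu] has length [m]. The sum of that length and the number of zeros left is constant along the
    run, so the bound [m] prevents this. *)
Lemma halts_shift m z nu mu : 0 < m -> is_partition nu ->
  count_mem 0 z + nth 0 nu 0 <= m ->
  halts (z, nu) mu -> halts (map succn z, m :: nu) (m :: mu).
Proof.
move=> m0 nuP le_m [k Ek]; exists k.
elim: k z nu nuP le_m Ek => [|k IH] z nu nuP le_m; first by case=> -> ->.
rewrite !iterSr; case/lastP: z le_m => [|z a] le_m Ek.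
  exact: (IH [::]).
have nuP' : is_partition (m :: nu) by rewrite is_partition_cons m0 nuP andbT; lia.
rewrite map_rcons catins_step_rcons //; rewrite catins_step_rcons // in Ek.
have -> : insertable (m :: nu) a.+1 = insertable nu a.
  move: le_m; rewrite /insertable -cats1 count_cat /=; case: a {Ek} => //=; lia.
have := is_partition_incr a nuP; move: Ek; case: ifP => ins Ek nuP''.
  apply: IH => //; rewrite nth_incr_nth; move: le_m; rewrite -cats1 count_cat /=.
  rewrite eq_sym; lia.
rewrite -map_cons; apply: IH => //.
by move: le_m; rewrite -cats1 count_cat /= addn0 add0n; lia.
Qed.

(** Letters that are at least 2 are never tested against row 0, and rejection only raises them. *)
Lemma halts_incr_nth0 y nu mu : is_partition nu -> all (leq 2) y ->
  halts (y, nu) mu -> halts (y, incr_nth nu 0) (incr_nth mu 0).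
Proof.
move=> nuP y2 [k Ek]; exists k.
elim: k y nu nuP y2 Ek => [|k IH] y nu nuP y2; first by case=> -> ->.
rewrite !iterSr; case/lastP: y y2 => [|y a] y2 Ek; first exact: (IH [::]).
have nuP' : is_partition (incr_nth nu 0) by rewrite is_partition_incr.
move: y2; rewrite all_rcons => /andP[a2 y2].
rewrite catins_step_rcons //; rewrite catins_step_rcons // in Ek.
have -> : insertable (incr_nth nu 0) a = insertable nu a.
  by move: a2; rewrite /insertable !nth_incr_nth; case: a {Ek} => [|[|a]].
have := is_partition_incr a nuP; move: Ek; case: ifP => ins Ek nuP''.
  by rewrite incr_nthC; apply: IH.
by apply: IH; rewrite //= ltnW.
Qed.

(* The letters behind the 0 are inserted or come back as letters that are at
   least 2, so that the first row does not matter any more once 0 is reached. *)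
Lemma halts_insert0 y x nu mu : is_partition nu -> all (leq 2) y ->
  halts (y ++ x, nu) mu -> halts (y ++ 0 :: x, nu) (incr_nth mu 0).
Proof.
elim/last_ind: x y nu => [|x a IH] y nu nuP y2 h.
  rewrite cats0 in h; rewrite cats1 -haltsS catins_step_rcons //=.
  exact: halts_incr_nth0.
rewrite -rcons_cons -rcons_cat -haltsS catins_step_rcons //.
rewrite -rcons_cat -haltsS catins_step_rcons // in h.
have := is_partition_incr a nuP; move: h; case: ifP => ins h nuP'; first exact: IH.
apply: (IH (a.+1 :: y)) => //=; rewrite y2 andbT.
by move: ins; rewrite /insertable; case: (a).
Qed.

Lemma cc_label_increasing (u : word) m :
  (forall j, 0 < j < m -> index j u < index j.+1 u) ->
  forall i, i <= m -> cc_label u i = 0.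
Proof.
move=> inc; elim=> // -[|i] IH lti //; rewrite cc_labelS // IH; last exact: ltnW.
by rewrite leqNgt inc.
Qed.

Lemma index_iota_cat (m i : nat) (s : word) : 0 < i <= m -> index i (iota 1 m ++ s) = i.-1.
Proof.
move=> lei; rewrite index_cat mem_iota add1n ltnS lei.
rewrite -[X in index X]prednK; last by lia.
have -> : i.-1.+1 = nth 0 (iota 1 m) i.-1 by rewrite nth_iota ?add1n //; lia.
by rewrite index_uniq ?size_iota ?iota_uniq //; lia.
Qed.

(** The number [m + 1] stands left of [m], which raises all later labels by 1. *)
Lemma cocharge_labeling_low_suffix m v : 0 < m -> standard v ->
  cocharge_labeling (map (addn m) v ++ iota 1 m) =
  map succn (cocharge_labeling v) ++ nseq m 0.
Proof.
move=> m0 std; set u := _ ++ _.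
have low i : i <= m -> (i \in map (addn m) v) = false.
  move=> le_im; apply/mapP => -[j]; rewrite (mem_standard _ std); lia.
have idx_low i : 0 < i <= m -> index i u = size v + i.-1.
  move=> lei; rewrite index_cat low ?size_map; last by lia.
  by rewrite -[iota 1 m]cats0 index_iota_cat.
have idx i : i \in v -> index (m + i) u = index i v.
  by move=> iv; rewrite index_cat map_f // index_map //; exact: addnI.
have lab0 i : i <= m -> cc_label u i = 0.
  by apply: cc_label_increasing => j ltj; rewrite !idx_low; lia.
rewrite /cocharge_labeling map_cat; congr cat.
  rewrite -!map_comp; apply/eq_in_map => i iv /=.
  have := iv; rewrite (mem_standard _ std) => le_i.
  have one_v : 1 \in v by rewrite (mem_standard _ std); lia.
  have lab1 : cc_label u m.+1 = 1.
    rewrite cc_labelS // lab0 // (idx_low m) ?m0 ?leqnn // -(addn1 m) idx //.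
    by have -> : index 1 v <= size v + m.-1 by rewrite ltnW // ltn_addr // index_mem.
  rewrite (@cc_label_shift u v m (size v)) ?lab1 ?add1n // => j ltj.
  by rewrite -addnS !idx //  (mem_standard _ std); lia.
apply: (@eq_from_nth _ 0); rewrite size_map size_iota ?size_nseq // => i lti.
by rewrite nth_nseq lti (nth_map 0) ?size_iota // nth_iota // lab0.
Qed.

(** The number [d + 1] stands right of [d], so its label is still 0. *)
Lemma cocharge_labeling_low_prefix d v : standard v ->
  cocharge_labeling (iota 1 d ++ map (addn d) v) = nseq d 0 ++ cocharge_labeling v.
Proof.
move=> std; set u := _ ++ _.
have idx_low i : 0 < i <= d -> index i u = i.-1 by exact: index_iota_cat.
have idx i : 0 < i -> index (d + i) u = d + index i v.
  move=> i0; rewrite index_cat mem_iota size_iota index_map; last exact: addnI.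
  by case: ifP => //; lia.
have lab0 i : i <= d -> cc_label u i = 0.
  by apply: cc_label_increasing => j ltj; rewrite !idx_low; lia.
rewrite /cocharge_labeling map_cat; congr cat.
  apply: (@eq_from_nth _ 0); rewrite size_map size_iota ?size_nseq // => i lti.
  by rewrite nth_nseq lti (nth_map 0) ?size_iota // nth_iota // lab0.
rewrite -map_comp; apply/eq_in_map => i iv /=.
have := iv; rewrite (mem_standard _ std) => le_i.
have lab1 : cc_label u d.+1 = 0.
  case: (d) lab0 idx_low idx => // e lab0 idx_low idx.
  rewrite cc_labelS // lab0 // -(addn1 e.+1) idx // (idx_low e.+1) ?leqnn //=.
  by rewrite leqNgt ltn_addr.
rewrite (@cc_label_shift u v d (size v)) ?lab1 ?add0n // => j ltj.
by rewrite -addnS !idx //; lia.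
Qed.

Lemma standard_low_prefix d v : standard v -> standard (iota 1 d ++ map (addn d) v).
Proof.
rewrite /standard => std; rewrite size_cat size_iota size_map iotaD perm_cat2l.
by rewrite addnC iotaDl perm_map.
Qed.

Lemma catins_output_low_prefix d v : standard v ->
  catins_output (iota 1 d ++ map (addn d) v) =
  iter d (incr_nth^~ 0) (catins_output v).
Proof.
move=> std; apply: catins_output_halts; rewrite cocharge_labeling_low_prefix //.
elim: d => [|d IH]; first exact/catins_output_halts_iff.
exact: (@halts_insert0 [::]).
Qed.

Lemma halts_zeros z m nu mu : is_partition nu ->
  halts (z, iter m (incr_nth^~ 0) nu) mu -> halts (z ++ nseq m 0, nu) mu.
Proof.
elim: m nu => [|m IH] nu nuP h; first by rewrite cats0.
rewrite -[m.+1]addn1 nseqD cats1 -rcons_cat -haltsS catins_step_rcons //=.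
by apply: IH; rewrite ?is_partition_incr // -iterSr.
Qed.

(** The trailing zeros build a first row of length [m]; beneath it the raised labels repeat the run
    of [v]. *)
Lemma catins_output_low_suffix m v : 0 < m -> standard v ->
  count_mem 0 (cocharge_labeling v) <= m ->
  catins_output (map (addn m) v ++ iota 1 m) = m :: catins_output v.
Proof.
move=> m0 std le_m; apply: catins_output_halts.
rewrite cocharge_labeling_low_suffix //; apply: halts_zeros => //.
have -> : iter m (incr_nth^~ 0) [::] = [:: m].
  by case: m m0 {le_m} => // m _; elim: m => //= m ->.
apply: halts_shift; rewrite ?addn0 //; exact/catins_output_halts_iff.
Qed.

(** The entries of [D] are corotated one at a time. Each exceeds [m], so its label is at least that
    of [m + 1], which is nonzero because [m + 1] in [A] stands left of [m]. *)
Lemma catins_output_corotations A m D : 0 < m -> standard (A ++ iota 1 m ++ D) ->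
  m.+1 \in A -> catins_output (A ++ iota 1 m ++ D) = catins_output (D ++ A ++ iota 1 m).
Proof.
move=> m0; elim/last_ind: D A => [|D a IH] A std SmA; first by rewrite cats0.
set u := A ++ _; have eu : u = rcons (A ++ iota 1 m ++ D) a by rewrite !rcons_cat.
have uu := standard_uniq std; have au : a \in u by rewrite eu mem_rcons mem_head.
have lt_ma : m < a.
  move: au; rewrite (mem_standard _ std) => /andP[a0 _]; rewrite ltnNge; apply/negP => le_am.
  move: uu; rewrite -/u eu rcons_uniq !mem_cat mem_iota a0 add1n ltnS le_am.
  by rewrite orbT.
have mA : m \notin A.
  move: uu; rewrite cat_uniq => /and3P[_ /hasPn dis _]; apply: dis.
  by rewrite mem_cat mem_iota m0 add1n ltnSn.
have cor : nonzero_corotation u (a :: A ++ iota 1 m ++ D).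
  exists (A ++ iota 1 m ++ D), a; split=> //; first by lia.
  have [|le_l _] := @cc_label_mono u m.+1 a; first by lia.
  apply: leq_trans le_l; rewrite cc_labelS // addn_gt0; apply/orP; right.
  rewrite lt0b index_cat SmA index_cat (negbTE mA) ltnW // ltn_addr //.
  by rewrite index_mem.
have [stdv ->] := catins_output_corotation std cor.
by rewrite -!cat_cons IH ?inE ?SmA ?orbT // cat_rcons.
Qed.

(** * Shifting all entries of a tableau *)

Lemma insertion_tableau_map m w :
  insertion_tableau (map (addn m) w) = map (map (addn m)) (insertion_tableau w).
Proof.
have row r a : insert_row (map (addn m) r) (m + a) =
    (map (addn m) (insert_row r a).1, omap (addn m) (insert_row r a).2).
  by elim: r => //= b r IH; rewrite ltn_add2l; case: ltnP => //=; rewrite IH; case: insert_row.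
have tab T a : insert_tableau (map (map (addn m)) T) (m + a) =
    map (map (addn m)) (insert_tableau T a).
  elim: T a => //= r T IH a; rewrite row; case: insert_row => r' [b|] //=.
  by rewrite IH.
elim/last_ind: w => // w a IH.
by rewrite map_rcons !insertion_tableau_rcons IH tab.
Qed.

Lemma rowword_map m T : rowword (map (map (addn m)) T) = map (addn m) (rowword T).
Proof. by rewrite /rowword -map_rev map_flatten. Qed.

(** A catabolism of a standard tableau has lost its smallest entries; shift invariance brings the
    recursion back to standard words. *)
Lemma catabolizable_rec_map m la T :
  catabolizable_rec la (map (map (addn m)) T) = catabolizable_rec la T.
Proof.
elim: la T => [|p la IH] T /=; first by case: T.
have -> : head [::] (map (map (addn m)) T) = map (addn m) (head [::] T) by case: T.
rewrite size_map; congr andb; congr andb.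
  rewrite /smallest_entries rowword_map -map_take.
  rewrite -(@map_sort _ _ (addn m) leq leq); last by move=> x y; rewrite leq_add2l.
  rewrite -map_take all_map; apply: eq_all => i /=; rewrite mem_map //; exact: addnI.
rewrite -[RHS]IH; congr catabolizable_rec; rewrite -insertion_tableau_map.
by rewrite /catabolism map_cat -rowword_map map_drop; case: T.
Qed.

(** * Catabolizability *)

Lemma head_semistandard_min T x : semistandard T -> x \in rowword T ->
  head [::] T != [::] /\ nth 0 (head [::] T) 0 <= x.
Proof.
elim: T => //= r T IH [sr [le_s col] sT]; rewrite rowword_cons mem_cat => /orP[xT|xr].
  have [] := IH sT xT; case: (head _ T) le_s col => //= y s le_s col _ le_yx.
  by split; [case: (r) le_s|apply: leq_trans le_yx; rewrite ltnW ?col].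
split; first by case: (r) xr.
rewrite -(nth_index 0 xr); apply: (sorted_leq_nth leq_trans leqnn) => //.
  by rewrite inE; case: (r) xr.
by rewrite inE index_mem.
Qed.

Lemma sorted_initial_segment k R : sorted ltn R -> all (leq k) R ->
  exists m D, R = iota k m ++ D /\ all (ltn (k + m)) D.
Proof.
elim: R k => [|c R IH] k sR /=; first by exists 0, [::].
move=> /andP[]; rewrite leq_eqVlt => /predU1P[-> _|lt_kc _].
  have [] := IH c.+1 (path_sorted sR); first exact: (order_path_min ltn_trans).
  move=> m [D [-> Dm]]; exists m.+1, D; split=> //; by rewrite addnS.
exists 0, (c :: R); split=> //=; rewrite addn0 lt_kc /=.
apply: sub_all (order_path_min ltn_trans sR) => x; exact: ltn_trans.
Qed.

Lemma standard_high_part m X : perm_eq X (iota m.+1 (size X)) ->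
  exists2 v, standard v & X = map (addn m) v.
Proof.
move=> permX; exists (map (subn^~ m) X).
  rewrite /standard size_map (permPl (perm_map _ permX)) -[m.+1]addn1 iotaDl -map_comp.
  by rewrite (eq_map (g := id)) ?map_id // => i /=; rewrite addKn.
rewrite -map_comp -[LHS]map_id; apply/eq_in_map => i /=.
rewrite (perm_mem permX) mem_iota => /andP[lt_mi _]; rewrite subnKC // ltnW //.
Qed.

(** The numbers labeled 0 form an initial segment, so more than [m] of them include [m + 1]. *)
Lemma cc_label_zero_of_count v m : standard v ->
  m < count_mem 0 (cocharge_labeling v) -> m.+1 <= size v /\ cc_label v m.+1 = 0.
Proof.
move=> std lt_m.
suff /andP[-> /eqP] : (m.+1 <= size v) && (cc_label v m.+1 == 0) by [].
apply: contraLR lt_m; rewrite negb_and -leqNgt => high.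
rewrite /cocharge_labeling count_map -size_filter.
rewrite -leqNgt -[X in _ <= X](size_iota 1 m); apply: uniq_leq_size.
  by rewrite filter_uniq ?standard_uniq.
move=> i; rewrite mem_filter (mem_standard _ std) mem_iota /= add1n ltnS.
move=> /and3P[/eqP eq0 -> le_i]; rewrite leqNgt; apply/negP => lt_mi.
case/orP: high => [|/eqP[]]; first by rewrite leqNgt (leq_trans lt_mi le_i).
have [|le_l _] := @cc_label_mono v m.+1 i; first by rewrite lt_mi.
by apply/eqP; rewrite -leqn0 -[X in _ <= X]eq0.
Qed.

Lemma index_of_zero_label v k i : cc_label v k = 0 -> 0 < i <= k ->
  index 1 v <= index i v.
Proof.
move=> lab0 /andP[i0 le_ik].
have [|_ le_idx] := @cc_label_mono v 1 i; first by rewrite i0.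
apply: le_idx; rewrite cc_label1; apply/esym/eqP; rewrite -leqn0 -lab0.
by have [|] := @cc_label_mono v i k; first by rewrite i0.
Qed.

Lemma second_row_meets_first m D S :
  sorted leq (iota 1 m ++ D) -> sorted leq S -> column_strict (iota 1 m ++ D) S ->
  all (ltn m) D -> (forall i, 0 < i <= m.+1 -> m + i \in S) ->
  exists2 e, e \in D & e \in S.
Proof.
set R := iota 1 m ++ D => sR sS [le_SR col] Dm in_S.
have SmS : m + m.+1 \in S by rewrite in_S // leqnn.
set k := index (m + m.+1) S.
have lt_k : k < size S by rewrite index_mem.
have nth_k : nth 0 S k = m + m.+1 by rewrite nth_index.
have le_mk : m <= k.
  rewrite -(size_iota m.+1 m) -[k](size_takel (ltnW lt_k)).
  apply: uniq_leq_size; first exact: iota_uniq.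
  move=> x; rewrite mem_iota => /andP[lt_mx]; rewrite addSnnS => lt_x.
  have xS : x \in S.
    by rewrite -(subnKC (ltnW lt_mx)) in_S // subn_gt0 lt_mx leq_subLR ltnW.
  rewrite in_take // ltnNge; apply/negP => le_k.
  have := sorted_leq_nth leq_trans leqnn 0 sS k (index x S).
  rewrite !inE lt_k index_mem xS nth_k nth_index // => /(_ isT isT le_k).
  by rewrite leqNgt lt_x.
have lt_kR : k < size R by exact: leq_trans le_SR.
have lt_mR : m < size R by exact: leq_ltn_trans lt_kR.
have lt_e : nth 0 R m < m + m.+1.
  rewrite -nth_k; apply: leq_ltn_trans (col _ lt_k).
  by apply: (sorted_leq_nth leq_trans leqnn).
have eD : nth 0 R m \in D.
  move: lt_mR; rewrite /R nth_cat size_cat size_iota ltnn subnn -{1}[m]addn0.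
  by rewrite ltn_add2l; exact: mem_nth.
exists (nth 0 R m) => //; have lt_me : m < nth 0 R m := allP Dm _ eD.
by rewrite -(subnKC (ltnW lt_me)) in_S // subn_gt0 lt_me leq_subLR ltnW.
Qed.

(* The zeros of the labeling start at the head of the second row and stay in
   it, so more than m of them would contradict column strictness. *)
Lemma count_zero_le m Ts D v : semistandard ((iota 1 m ++ D) :: Ts) ->
  m.+1 \notin D -> standard v -> D ++ rowword Ts = map (addn m) v ->
  count_mem 0 (cocharge_labeling v) <= m.
Proof.
move=> [sR col sTs] SmD std eX; rewrite leqNgt; apply/negP => lt_m.
have [le_Sm lab0] := cc_label_zero_of_count std lt_m.
set X := D ++ rowword Ts in eX.
have memX (i : nat) : (i \in X) = (m < i <= m + size v).
  rewrite eX; apply/mapP/idP => [[j]|h].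
    rewrite (mem_standard _ std); lia.
  by exists (i - m); rewrite ?(mem_standard _ std); lia.
have SmX : m.+1 \in X by rewrite memX ltnSn -addn1 leq_add2l (leq_trans _ le_Sm).
have SmTs : m.+1 \in rowword Ts by move: SmX; rewrite mem_cat (negbTE SmD).
have [Hne le_head] := head_semistandard_min sTs SmTs.
case: Ts => // S Ts in col sTs X eX memX SmX SmTs Hne le_head *.
rewrite /= in col Hne le_head; have sS : sorted leq S by case: sTs.
have sub_X : {subset S <= X}.
  by move=> i h; rewrite mem_cat rowword_cons mem_cat h !orbT.
have SmS : m.+1 \in S.
  have h : nth 0 S 0 \in S by apply: mem_nth; case: (S) Hne.
  suff <- : nth 0 S 0 = m.+1 by [].
  apply/eqP; rewrite eqn_leq le_head.
  by have := sub_X _ h; rewrite memX => /andP[].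
have uX : uniq X by rewrite eX map_inj_uniq ?standard_uniq //; exact: addnI.
have eXS : X = (D ++ rowword Ts) ++ S by rewrite /X rowword_cons catA.
have /hasPn dis : ~~ has [in D ++ rowword Ts] S.
  by move: uX; rewrite eXS cat_uniq => /and3P[].
(* Each [m + i] is at or to the right of [m + 1] in [X], and [m + 1] already lies in the last factor
   [S]. *)
have in_S i : 0 < i <= m.+1 -> m + i \in S.
  move=> lei; have := index_of_zero_label lab0 lei.
  rewrite -(index_map (@addnI m)) -[index i v](index_map (@addnI m)) -eX.
  have : m + i \in X.
    case/andP: lei => i0 le_i.
    by rewrite memX -addn1 leq_add2l i0 leq_add2l (leq_trans le_i).
  rewrite eXS !(index_cat _ (D ++ rowword Ts)) addn1 (negbTE (dis _ SmS)).
  rewrite mem_cat => /orP[iDT|//].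
  by rewrite iDT => /(leq_trans (leq_addr _ _)); rewrite leqNgt index_mem iDT.
have [|e eD eS] := second_row_meets_first sR sS col _ in_S.
  by apply/allP => i iD; have := memX i; rewrite mem_cat iD => /esym/andP[].
by have := dis e eS; rewrite /= mem_cat eD.
Qed.

(** One round of the recursion, used for both halves of the maximality: [v] is [D ++ rowword Ts]
    shifted down to a standard word, so up to the shift its insertion tableau is the
    [m]-catabolism. *)
Lemma catabolism_decomposition u : standard u -> u != [::] ->
  exists R Ts m D v,
    [/\ insertion_tableau u = R :: Ts, R = iota 1 m ++ D, m.+1 \notin R,
        standard v & D ++ rowword Ts = map (addn m) v] /\
    [/\ 0 < m, size u = m + size v & catins_output u = m :: catins_output v].
Proof.
move=> std une; have sT := semistandard_insertion u.
have [stdT ->] := catins_output_knuth_equiv (knuth_equiv_insertion u) std.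
have sizeT := size_rowword_insertion u.
rewrite -sizeT -size_eq0 -sizeT in une *.
move: stdT sT une; case: (insertion_tableau u) => // R Ts stdT sT une.
rewrite -lt0n in une; have uT := standard_uniq stdT.
have [sR _ _] := sT.
have [||m [D [eR Dm]]] := @sorted_initial_segment 1 R.
- rewrite ltn_sorted_uniq_leq sR andbT.
  by move: uT; rewrite rowword_cons cat_uniq => /and3P[].
- apply/allP => i iR; have := mem_standard i stdT.
  by rewrite rowword_cons mem_cat iR orbT => /esym/andP[].
have SmR : m.+1 \notin R.
  rewrite eR mem_cat mem_iota add1n ltnn andbF /=.
  by apply/negP => /(allP Dm); rewrite /= add1n ltnn.
have m0 : 0 < m.
  have one_T : 1 \in rowword (R :: Ts) by rewrite (mem_standard _ stdT).
  have [Rne le_1] := head_semistandard_min (T := R :: Ts) sT one_T.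
  case: m eR {SmR} Dm => // eR Dm; move: Rne le_1; rewrite /= eR.
  by case: (D) Dm => //= d s /andP[]; lia.
pose X := D ++ rowword Ts.
have permX : perm_eq X (iota m.+1 (size X)).
  have := stdT; rewrite /standard rowword_cons eR catA perm_sym.
  have -> : size ((rowword Ts ++ iota 1 m) ++ D) = m + size X.
    by rewrite !size_cat size_iota; lia.
  rewrite iotaD add1n perm_sym => h; rewrite -(perm_cat2l (iota 1 m)).
  rewrite -(permPr h) /X catA perm_catC catA; apply: perm_refl.
have [v stdv eX] := standard_high_part permX.
exists R, Ts, m, D, v; split=> //; split=> //.
  by rewrite rowword_cons eR !size_cat size_iota -(size_map (addn m) v) -eX size_cat; lia.
have -> : catins_output (rowword (R :: Ts)) = catins_output (D ++ rowword Ts ++ iota 1 m).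
  (* An empty [D] needs no corotation; otherwise [X] is nonempty and its least entry [m + 1], absent
     from [R], lies in [rowword Ts]. *)
  rewrite rowword_cons eR; case ED: D => [|d s]; first by rewrite cats0.
  rewrite -ED; apply: catins_output_corotations => //; first by rewrite -eR -rowword_cons.
  have : m.+1 \in X by rewrite (perm_mem permX) mem_iota leqnn /X ED /=; lia.
  move: SmR; rewrite eR !mem_cat negb_or => /andP[_ /negbTE ->] //.
rewrite catA -/X eX; apply: catins_output_low_suffix => //.
apply: count_zero_le stdv eX; first by rewrite -eR.
by move: SmR; rewrite eR mem_cat negb_or => /andP[].
Qed.

Lemma smallest_entries_standard m T : standard (rowword T) -> m <= size (rowword T) ->
  smallest_entries m T = iota 1 m.
Proof.
rewrite /smallest_entries /standard => std le_m.
have -> : sort leq (rowword T) = iota 1 (size (rowword T)).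
  apply: (sorted_eq leq_trans anti_leq); rewrite ?iota_sorted ?perm_sort //.
  exact: (sort_sorted leq_total).
by rewrite take_iota (minn_idPl le_m).
Qed.

Lemma catins_output_nil : catins_output [::] = [::].
Proof. by apply: catins_output_halts; exists 0. Qed.

Lemma catabolizable_rec_output u : standard u ->
  catabolizable_rec (catins_output u) (insertion_tableau u).
Proof.
have [n] := ubnP (size u); elim: n u => // n IH u le_n std.
have [->|une] := eqVneq u [::]; first by rewrite catins_output_nil.
have [R [Ts [m [D [v [[eT eR SmR stdv eX] [m0 size_u ->]]]]]]] :=
  catabolism_decomposition std une.
have stdT := standard_rowword std; rewrite eT in stdT *.
have le_mR : m <= size R by rewrite eR size_cat size_iota leq_addr.
rewrite /= le_mR smallest_entries_standard //; last first.
  by rewrite rowword_cons size_cat (leq_trans le_mR) // leq_addl.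
have -> : take m R = iota 1 m by rewrite eR take_size_cat ?size_iota.
apply/andP; split=> //; apply/andP; split; first exact/allP.
have -> : catabolism m (R :: Ts) = map (map (addn m)) (insertion_tableau v).
  rewrite -insertion_tableau_map -eX /catabolism /= eR drop_size_cat ?size_iota //.
by rewrite catabolizable_rec_map; apply: IH => //; lia.
Qed.

(** Induction on [mu]: its first part [p] is at most [m], and taking fewer entries than [m] leaves
    squares that count at most as much in every partial sum. *)
Lemma catabolizable_dominated mu u : standard u -> 0 \notin mu ->
  catabolizable_rec mu (insertion_tableau u) -> dominated mu (catins_output u).
Proof.
elim: mu u => [|p mu IH] u std; first by move=> _ _ [].
rewrite inE negb_or eq_sym -lt0n => /andP[p0 mu0].
have [->|une] := eqVneq u [::]; first by case: p p0.
have [R [Ts [m [D [v [[eT eR SmR stdv eX] [m0 size_u ->]]]]]]] :=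
  catabolism_decomposition std une.
have stdT := standard_rowword std; rewrite eT in stdT *.
move=> /= /and3P[le_pR]; rewrite smallest_entries_standard //; last first.
  by rewrite rowword_cons size_cat (leq_trans le_pR) // leq_addl.
move=> /allP sub_p.
have le_pm : p <= m.
  rewrite leqNgt; apply: contra SmR => lt_mp; apply: (@mem_take p).
  by apply: sub_p; rewrite mem_iota add1n ltnS.
pose d := m - p; have em : m = p + d by rewrite subnKC.
(* The word of [cat_p] is [p + 1 ... m] followed by that of [cat_m]; lowered by [p] it is [1 ... d]
   followed by [v] raised by [d]. *)
have -> : catabolism p (R :: Ts) =
    map (map (addn p)) (insertion_tableau (iota 1 d ++ map (addn d) v)).
  rewrite -insertion_tableau_map map_cat -iotaDl addn1 -map_comp.
  rewrite (eq_map (g := addn m)); last by move=> i /=; rewrite em addnA.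
  by rewrite -eX /catabolism /= eR em iotaD -!catA drop_size_cat ?size_iota // add1n catA.
rewrite catabolizable_rec_map => /(IH _ (standard_low_prefix d stdv) mu0).
rewrite catins_output_low_prefix // => dom.
(* The [d] squares that enlarge the first row of the output of [v] add at most [d] to a partial sum,
   and [m = p + d]. *)
move=> [|k] //=; rewrite em -addnA leq_add2l; apply: leq_trans (dom k) _.
elim: (d) => [|e IHe] //=; exact: leq_trans (sumn_take_incr_nth0 _ _) _.
Qed.

(** The output is catabolizable and dominates every catabolizable partition, so antisymmetry makes
    it the only maximal one. *)
Lemma ctype_insertion_tableau u : standard u ->
  ctype (insertion_tableau u) = catins_output u.
Proof.
move=> std; set T := insertion_tableau u; set F := catins_output u.
have catF : catabolizable F T.
  rewrite /catabolizable size_rowword_insertion catins_output_partition //.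
  exact: catabolizable_rec_output.
have dom mu : catabolizable mu T -> dominated mu F.
  move=> /andP[/andP[/andP[_ mu0] _]]; exact: catabolizable_dominated.
have part mu : catabolizable mu T -> is_partition mu by case/andP=> /andP[].
have maxF mu : maximal_catabolizable T mu <-> mu = F.
  split=> [[cat_mu max_mu]|->]; first by rewrite (max_mu F catF (dom _ cat_mu)).
  split=> // mu' cat_mu' dom'.
  by apply: dominated_anti => //; [exact: part..|exact: dom].
apply: xget_unique => [|la /(_ la)[_ h]] //; apply/maxF; exact: h.
Qed.

Theorem theorem3p4 (n : nat) (u : word) (size_u : size u = n)
    (std_u : standard u) :
  (forall (k : nat) (x : word) (nu : seq nat),
     catins_state u k = (x, nu) ->
     exists v : word,
       standard v /\ cocharge_labeling v = x ++ rowword (superstandard nu)) /\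
  (exists k : nat, k <= n + 'C(n, 2) /\ (catins_state u k).1 = [::]) /\
  (forall v : word, nonzero_corotation u v ->
     catins_output u = catins_output v) /\
  (forall v : word, catabolism_transformation u v ->
     catins_output u = catins_output v) /\
  (forall v : word, knuth_transformation u v ->
     catins_output u = catins_output v) /\
  catins_output u = ctype (insertion_tableau u).
Proof.
split=> [k x nu E|].
  by have := catins_state_labeling k std_u; rewrite E.
split; first by exists (n + 'C(n, 2)); rewrite -size_u catins_state_end.
split=> [v /catins_output_corotation[]//|].
split=> [v|]; first exact: catins_output_catabolism_transformation.
split=> [v /catins_output_knuth[]//|].
by rewrite ctype_insertion_tableau.
Qed.
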